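(* Let $q$ be an odd prime power with $q\equiv 1\pmod 4$, let $a,b,c\in F_q^\ast$ with $ab=c^2$. For $i,j,k\in F_q$ put $f(i,j,k)=ij-(k-i-j)^2/4\in F_q$. Then the following hold. 1. For all $j,k\in F_q^+$: $n_{0j}^k=1$ if $j=k$, and $n_{0j}^k=0$ otherwise. 2. Let $i,j\in F_q^\ast$. (a) If $k\in F_q^\ast$, then \[ n_{ij}^k=\begin{cases}0 & \text{if } f(i,j,k)\text{ is a non-square in } F_q,\\ 1/(q-1) & \text{if } f(i,j,k)=0,\\ 2/(q-1) & \text{if } f(i,j,k)\text{ is a non-zero square in } F_q.\end{cases} \] (b) If $k=0$, then $n_{ij}^0=1/(q-1)$ if $i=j$, and $n_{ij}^0=0$ otherwise. (c) If $k=q$, then $n_{ij}^q=0$ if $i=j$, and $n_{ij}^q=2/(q-1)$ otherwise. 3. Let $i=q$ and $k\in F_q^+$. (a) If $j\in F_q^\ast$, then $n_{qj}^k=1/(q-1)$ if $j\neq k$, and $n_{qj}^k=0$ otherwise. (b) If $j=q$, then $n_{qq}^k=\frac{1}{2(q-1)}$ if $k\in F_q$, and $n_{qq}^k=\frac{q-2}{2(q-1)}$ otherwise (that is, if $k=q$).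
   Context: $F_q$ is the finite field with $q$ elements, $F_q^\ast$ its set of non-zero elements, and $F_q^+=F_q\cup\{q\}$, where $q$ is used as one extra formal index not in $F_q$ (different from $0\in F_q$). For $i\in F_q^\ast$ let $C_i=\{(x,y)\in F_q^2: ax^2+by^2=i\}$; let $C_0=\{(0,0)\}$ and $C_q=\{(x,y)\in F_q^2: ax^2+by^2=0,\ (x,y)\ne(0,0)\}$. For $i,j,k\in F_q^+$ let $N_{ij}^k$ be the number of pairs $(A,B)\in C_i\times C_j$ with $A+B\in C_k$, and $n_{ij}^k=N_{ij}^k/(|C_i||C_j|)$.
   Formalization: In 3(a) the case k=0 is corrected: n_{qj}^0=0 for j in F_q^* (the text's 1/(q-1) is false there, since A+B=(0,0) would put B=-A in C_q, not C_j); the value 1/(q-1) is stated for k different from both j and 0. *)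

(* Defs.v *)
From mathcomp Require Import all_boot all_order all_algebra.
Set Implicit Arguments.
Unset Strict Implicit.
Unset Printing Implicit Defensive.
Import GRing.Theory.
Local Open Scope ring_scope.

(* The index set F_q^+ is [option F]: [Some i] is the element i of F and
   [None] is the extra formal index q. *)
Definition C (F : finFieldType) (a b : F) (i : option F) : {set F * F} :=
  match i with
  | None => [set p : F * F | (a * p.1 ^+ 2 + b * p.2 ^+ 2 == 0) && (p != (0, 0))]
  | Some i => if i == 0 then [set (0, 0)]
              else [set p : F * F | a * p.1 ^+ 2 + b * p.2 ^+ 2 == i]
  end.

Definition N (F : finFieldType) (a b : F) (i j k : option F) : nat :=
  #|[set AB : (F * F) * (F * F) |
      [&& AB.1 \in C a b i, AB.2 \in C a b j & AB.1 + AB.2 \in C a b k]]|.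

Definition n (F : finFieldType) (a b : F) (i j k : option F) : rat :=
  (N a b i j k)%:R / (#|C a b i|%:R * #|C a b j|%:R).

Definition f (F : finFieldType) (i j k : F) : F :=
  i * j - (k - i - j) ^+ 2 / 4.

Definition is_square (F : finFieldType) (x : F) : bool :=
  [exists y : F, x == y ^+ 2].

(* Main.v *)
(** Since [-1 = s^2], the form [a x^2 + b y^2] factors as [u v] with
    [u = a x + s c y] and [v = x - (s c / a) y], and all the counts can be made
    for the form [u v].  For a point [A] of the i-th class, the number of [B] in
    the j-th class with [A + B] in the k-th class does not depend on [A], so
    that [n_ij^k] is this number divided by [|C_j|].  For [A = (u, v)] and
    [B = (x, y)] with [u v = i], [x y = j], the condition [A + B \in C_k] fixes
    the sum [m = k - i - j] of [x v] and [u y], whose product is [i j]; hence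
    [f i j k = i j - m^2 / 4 = (s (x v - u y) / 2)^2], and [B] is determined by
    the square root [s (x v - u y) / 2] of [f i j k]. *)
Require Import Defs.
From mathcomp Require Import all_boot all_order all_algebra all_field.
From mathcomp Require Import ring.
Import GRing.Theory Num.Theory.
Local Open Scope ring_scope.

(** * Finite-field preliminaries: characteristic, a square root of -1, counting square roots *)

(** Translation by 1 permutes [F], so adding 1 to every term leaves the sum of all elements
    unchanged. *)
Lemma natr_card_finField (F : finFieldType) : #|F|%:R = 0 :> F.
Proof.
have : \sum_(x : F) (x + 1) = \sum_(x : F) x.
  by rewrite [RHS](reindex_inj (addIr 1)).
by rewrite big_split /= sumr_const => /(canRL (addKr _)); rewrite addNr.
Qed.

Lemma odd_card_natr2_neq0 (F : finFieldType) : odd #|F| -> 2 != 0 :> F.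
Proof.
move=> oddF; apply/negP => /eqP F2; have := natr_card_finField F.
rewrite -(odd_double_half #|F|) oddF -muln2 natrD natrM F2 mulr0 addr0.
by move/eqP; rewrite oner_eq0.
Qed.

(** With [#|F|] = 4m + 1, the polynomial X^(2m) - 1 has at most 2m roots among the 4m non-zero
    elements. Any non-root x satisfies x^(4m) = 1, hence x^(2m) = -1, and x^m is the required
    root. *)
Lemma sqrtN1_finField (F : finFieldType) :
  #|F| = 1 %[mod 4] -> exists s : F, s ^+ 2 = -1.
Proof.
move=> F1; pose m := (#|F| %/ 4)%N.
have FE : #|F| = (m * 4).+1 by rewrite [LHS](divn_eq _ 4) F1 addn1.
have m_gt0 : (0 < m)%N.
  by have := finNzRing_gt1 F; rewrite FE; case: (m).
have [x x0 x1] : exists2 x : F, x != 0 & x ^+ (m * 2) != 1.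
  apply/exists_inP; rewrite -[X in is_true X]negbK negb_exists_in; apply/negP => /forall_inP H.
  have /max_unity_roots : all (m * 2).-unity_root (enum [pred x : F | x != 0]).
    by apply/allP => x; rewrite mem_enum unity_rootE => /H /negPn.
  rewrite muln_gt0 m_gt0 enum_uniq -cardE => /(_ isT isT).
  have -> : #|[pred x : F | x != 0]| = #|predC1 (0 : F)| by apply: eq_card.
  by rewrite cardC1 FE /= leq_pmul2l.
exists (x ^+ m); rewrite -exprM.
have : (x ^+ (m * 2)) ^+ 2 == 1.
  rewrite -exprM -mulnA; apply/eqP/(mulfI x0).
  by rewrite -exprS -FE expf_card mulr1.
by rewrite sqrf_eq1 (negPf x1) => /eqP.
Qed.

Lemma card_sqrt (F : finFieldType) (x : F) : 2 != 0 :> F ->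
  #|[set r : F | r ^+ 2 == x]| =
    if ~~ is_square x then 0%N else if x == 0 then 1%N else 2%N.
Proof.
move=> F2; case: ifPn => [/existsPn sqx | /negPn/existsP[r /eqP->]].
  by apply: eq_card0 => r; rewrite !inE eq_sym (negPf (sqx r)).
rewrite sqrf_eq0; case: ifPn => [/eqP-> | r0].
  by rewrite -[RHS](cards1 (0 : F)); apply: eq_card => t; rewrite !inE expr0n sqrf_eq0.
transitivity #|[set r; - r]|.
  by apply: eq_card => t; rewrite !inE eqf_sqr.
by rewrite cards2 -addr_eq0 -mulr2n -mulr_natl mulf_neq0.
Qed.

(* The classes [C] for the form [u v]. *)
Definition hyperbola {F : finFieldType} (i : option F) : {set F * F} :=
  match i with
  | None => [set p : F * F | (p.1 * p.2 == 0) && (p != (0, 0))]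
  | Some i => if i == 0 then [set (0, 0)] else [set p : F * F | p.1 * p.2 == i]
  end.

(** The injective additive map [phi] carries each class [C a b l] to the class [hyperbola l].
    Summing the constant fibre size [m] over A gives N = [#|hyperbola i| * m], and non-emptiness of
    the i-th class allows its size to be cancelled. *)
Lemma n_hyperbola (F : finFieldType) (a b c s : F) (i j k : option F) (m : nat) :
    2 != 0 :> F -> a != 0 -> c != 0 -> a * b = c ^+ 2 -> s ^+ 2 = -1 ->
    (0 < #|hyperbola i|)%N ->
    (forall A, A \in hyperbola i ->
       #|[set B in hyperbola j | A + B \in hyperbola k]| = m) ->
  n a b i j k = m%:R / #|hyperbola j|%:R.
Proof.
move=> F2 a0 c0 hab s2 i_gt0 Hm.
have s0 : s != 0 by rewrite -sqrf_eq0 s2 oppr_eq0 oner_eq0.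
pose phi (p : F * F) := (a * p.1 + s * c * p.2, p.1 - s * c / a * p.2).
have phi0 : phi (0, 0) = (0, 0) by rewrite /phi /= !mulr0 addr0 subr0.
have phiD A B : phi (A + B) = phi A + phi B.
  by congr pair; rewrite /=; ring.
have phi_inj : injective phi.
  move=> [x y] [x' y'] [/= e1 e2].
  have ey : y = y'.
    (* The first coordinate minus a times the second is 2scy, which recovers y. *)
    apply: (mulfI (mulf_neq0 F2 (mulf_neq0 s0 c0))).
    have -> : 2 * (s * c) * y = a * x + s * c * y - a * (x - s * c / a * y) by field.
    by rewrite e1 e2; field.
  by rewrite ey in e2 *; rewrite (addIr _ e2).
have phiM p : (phi p).1 * (phi p).2 = a * p.1 ^+ 2 + b * p.2 ^+ 2.
  have -> : b = c ^+ 2 / a by rewrite -hab; field.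
  (* Writing c^2 as -(s^2 c^2) makes the goal an identity in free variables, within reach of
     [field]. *)
  rewrite -[c ^+ 2]opprK -[- c ^+ 2]mulN1r -s2 /=; field; exact: a0.
have phiC l : C a b l = phi @^-1: hyperbola l.
  apply/setP=> p; rewrite inE; case: l => [l|] /=; last first.
    by rewrite !inE phiM -{2}phi0 (inj_eq phi_inj).
  by case: ifP; rewrite !inE ?phiM // -{2}phi0 (inj_eq phi_inj).
have NE : N a b i j k = (#|hyperbola i| * m)%N.
  rewrite /N -sum1dep_card.
  rewrite -(pair_big_dep (mem (C a b i))
    (fun A B => (B \in C a b j) && (A + B \in C a b k)) (fun _ _ => 1%N)) /=.
  rewrite -(card_preimset (hyperbola i) phi_inj) -phiC -sum_nat_const.
  apply: eq_bigr => A; rewrite phiC inE => /Hm <-.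
  rewrite sum1dep_card -[RHS](card_preimset _ phi_inj); apply: eq_card => B.
  by rewrite !phiC !inE phiD.
rewrite /n NE !phiC !(card_preimset _ phi_inj) natrM -mulf_div divff ?mul1r //.
by rewrite pnatr_eq0 -lt0n.
Qed.

(** * Class sizes and fibre counts for the form uv *)

Section Counts.
Variable F : finFieldType.
Implicit Types (i j k : F) (A B : F * F).

Lemma card_hyperbola0 : #|@hyperbola F (Some 0)| = 1%N.
Proof. by rewrite /= eqxx cards1. Qed.

Lemma card_hyperbola i : i != 0 -> #|hyperbola (Some i)| = #|F|.-1.
Proof.
move=> i0; rewrite -(cardC1 (0 : F)) /= (negPf i0).
have inj : injective (fun u : F => (u, i / u)) by move=> u v [].
rewrite -(card_imset _ inj); apply: eq_card => -[u v]; rewrite inE /=.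
apply/eqP/imsetP => [uv | [t]]; last first.
  by rewrite inE /= => t0 [-> ->]; rewrite mulrC divfK.
have u0 : u != 0 by apply: contraNneq i0 => u0; rewrite -uv u0 mul0r.
by exists u; rewrite ?inE // -uv mulrC mulKf.
Qed.

Lemma axesP A : reflect
  (exists2 t, t != 0 & A = (t, 0) \/ A = (0, t)) (A \in hyperbola None).
Proof.
case: A => u v; rewrite !inE /= mulf_eq0 xpair_eqE negb_and.
apply: (iffP andP) => [[/orP[]/eqP-> /orP[]] | [t t0 []]].
- by rewrite eqxx.
- by exists v; auto.
- by exists u; auto.
- by rewrite eqxx.
- by case=> -> ->; rewrite t0 eqxx orbT.
- by case=> -> ->; rewrite t0 eqxx orbT.
Qed.

Lemma card_axes : #|@hyperbola F None| = (2 * #|F|.-1)%N.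
Proof.
have injl : injective (fun u : F => (u, 0 : F)) by move=> u v [].
have injr : injective (fun u : F => (0 : F, u)) by move=> u v [].
rewrite mul2n -addnn -(cardC1 (0 : F)).
rewrite -{1}(card_imset _ injl) -(card_imset _ injr).
rewrite -cardsUI (eq_card0 (A := mem (_ :&: _))) ?addn0 => [|A]; last first.
  rewrite !inE; apply/negP.
  by case/andP=> /imsetP[t t0 ->] /imsetP[t' _ [e _]]; rewrite inE e eqxx in t0.
apply: eq_card => A; apply/axesP/setUP.
  by move=> [t t0 []->]; [left | right]; rewrite imset_f.
by move=> [] /imsetP[t t0 ->]; exists t => //; auto.
Qed.

Lemma card_hyperbola_gt0 (i : option F) : (0 < #|hyperbola i|)%N.
Proof.
have F1 : (0 < #|F|.-1)%N by rewrite -subn1 subn_gt0 finNzRing_gt1.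
case: i => [i|]; last by rewrite card_axes muln_gt0.
by have [->|i0] := eqVneq i 0; rewrite ?card_hyperbola0 ?card_hyperbola.
Qed.

(** The product of the coordinates determines the index, except that the value 0 is shared by the
    origin and the punctured axes; [none] separates these two. *)
Lemma hyperbola_inj (j k : option F) A :
  A \in hyperbola j -> A \in hyperbola k -> j = k.
Proof.
have none i : A \in hyperbola (Some i) -> A \in hyperbola None -> False.
  rewrite /=; case: eqP => [_|/eqP i0]; rewrite !inE; first by move=> ->; rewrite andbF.
  by move=> /eqP->; rewrite (negPf i0).
case: j k => [j|] [k|] // Hj Hk; [|by case: (none _ Hj)|by case: (none _ Hk)].
move: Hj Hk => /=; have [->|j0] := eqVneq j 0; have [->|k0] := eqVneq k 0 => //;
  rewrite !inE.
- by move=> /eqP->; rewrite /= mul0r eq_sym (negPf k0).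
- by move=> + /eqP e; rewrite e /= mul0r eq_sym (negPf j0).
- by move=> /eqP-> /eqP->.
Qed.

Lemma count_origin (j k : option F) A : A \in hyperbola (Some 0) ->
  #|[set B in hyperbola j | A + B \in hyperbola k]| =
    if j == k then #|hyperbola j| else 0%N.
Proof.
rewrite /= eqxx inE => /eqP->.
have [->|jk] := eqVneq j k.
  by apply: eq_card => B; rewrite inE add0r andbb.
apply: eq_card0 => B; rewrite !inE add0r; apply/negP => /andP[Hj Hk].
by rewrite (hyperbola_inj _ _ _ Hj Hk) eqxx in jk.
Qed.

Lemma oppr_hyperbola (i : option F) A :
  (- A \in hyperbola i) = (A \in hyperbola i).
Proof.
have opp0 : (- A == (0, 0)) = (A == (0, 0)) by exact: (oppr_eq0 A).
by case: i => [i|] /=; [case: ifP => _|]; rewrite !inE ?opp0 //= mulrNN.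
Qed.

(** The only candidate is B = -A, which lies in the class of A because the form is even. *)
Lemma count_opposite (i j : option F) A : A \in hyperbola i ->
  #|[set B in hyperbola j | A + B \in hyperbola (Some 0)]| =
    if i == j then 1%N else 0%N.
Proof.
move=> Ai; transitivity #|[set B in hyperbola j | B == - A]|.
  by apply: eq_card => B; rewrite !inE /= eqxx inE addrC (addr_eq0 B A).
case: eqVneq => [<-|ij].
  rewrite -[RHS](cards1 (- A)); apply: eq_card => B; rewrite !inE.
  by case: eqP => [->|]; rewrite ?oppr_hyperbola ?Ai ?andbF.
apply: eq_card0 => B; rewrite !inE; apply/negP => /andP[Bj /eqP eB].
by move: Bj; rewrite eB oppr_hyperbola => /(hyperbola_inj _ _ _ Ai) /eqP; rewrite (negPf ij).
Qed.

Lemma count_hyperbola (s : F) i j k A : 2 != 0 :> F -> s ^+ 2 = -1 ->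
    i != 0 -> j != 0 -> k != 0 -> A \in hyperbola (Some i) ->
  #|[set B in hyperbola (Some j) | A + B \in hyperbola (Some k)]| =
    if ~~ is_square (f i j k) then 0%N else if f i j k == 0 then 1%N else 2%N.
Proof.
move=> F2 s2 i0 j0 k0.
have F4 : 4 != 0 :> F by rewrite -[4%N]/(2 * 2)%N natrM mulf_neq0.
case: A => u v; rewrite -card_sqrt // /= (negPf i0) (negPf j0) (negPf k0).
rewrite inE /= => /eqP uv.
have s0 : s != 0 by rewrite -sqrf_eq0 s2 oppr_eq0 oner_eq0.
have u0 : u != 0 by apply: contraNneq i0 => u0; rewrite -uv u0 mul0r.
have v0 : v != 0 by apply: contraNneq i0 => v0; rewrite -uv v0 mulr0.
(* Half of the sum xv + uy imposed by the condition on A + B. *)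
pose m := (k - i - j) / 2.
have fE : f i j k = i * j - m ^+ 2.
  by rewrite /f /m; field; rewrite ?F2 ?F4.
(* Solution of xv + uy = 2m and s(xv - uy)/2 = r, using s^2 = -1: xv = m - sr and uy = m + sr. *)
pose g r := ((m - s * r) / v, (m + s * r) / u).
have g_inj : injective g.
  move=> r r' [_ /(mulIf (invr_neq0 u0))/addrI]; exact: mulfI.
rewrite -(card_imset _ g_inj); apply: eq_card => -[x y]; rewrite !inE /=.
apply/andP/imsetP => [[/eqP xy /eqP xyk] | [r]].
  have mE : m = (x * v + u * y) / 2.
    by rewrite /m -xyk -uv -xy; congr (_ / 2); ring.
  exists (s * (x * v - u * y) / 2).
    rewrite inE fE mE -uv -xy !exprMn s2; apply/eqP; field; exact: F2.
  rewrite /g; congr pair; rewrite !mulrA -expr2 s2 mE; field; by rewrite ?F2 ?u0 ?v0.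
rewrite inE fE => /eqP r2 [-> ->].
have P : (m - s * r) * (m + s * r) = i * j.
  have -> : i * j = m ^+ 2 + r ^+ 2 by rewrite r2; ring.
  by rewrite -subr_sqr [(s * r) ^+ 2]exprMn s2 mulN1r opprK.
have P1 : (m - s * r) / v * ((m + s * r) / u) = j.
  rewrite mulf_div P mulrC -[v * u]mulrC uv mulKf //.
split; apply/eqP=> //.
have -> : (u + (m - s * r) / v) * (v + (m + s * r) / u)
    = u * v + 2 * m + (m - s * r) / v * ((m + s * r) / u).
  by field; rewrite u0 v0.
by rewrite P1 uv /m; field; exact: F2.
Qed.

(** A coordinate of A + B vanishes only for B = (-u, -j/u) or B = (-j/v, -v). If i = j both equal -A
    and the sum is the origin, which is excluded; otherwise they are two distinct solutions. *)
Lemma count_hyperbola_axes i j A : i != 0 -> j != 0 ->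
    A \in hyperbola (Some i) ->
  #|[set B in hyperbola (Some j) | A + B \in hyperbola None]| =
    if i == j then 0%N else 2%N.
Proof.
move=> i0 j0; case: A => u v; rewrite /= (negPf i0) (negPf j0) inE /= => /eqP uv.
have u0 : u != 0 by apply: contraNneq i0 => u0; rewrite -uv u0 mul0r.
have v0 : v != 0 by apply: contraNneq i0 => v0; rewrite -uv v0 mulr0.
have [ij|ij] := eqVneq i j.
  apply: eq_card0 => -[x y]; rewrite !inE /=; apply/negP.
  move=> /and3P[/eqP xy S0 /negP[]].
  have S : u * v = x * y by rewrite uv xy.
  (* From uv = xy follow u(v + y) = (u + x)y and v(u + x) = (v + y)x, so either coordinate vanishes
     with the other. *)
  have [ux vy] : u + x = 0 /\ v + y = 0.
    move: S0; rewrite mulf_eq0 => /orP[]/eqP e; split=> //.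
      by apply: (mulfI u0); rewrite mulr0 mulrDr S -mulrDl addrC e mul0r.
    apply: (mulfI v0).
    by rewrite mulr0 mulrDr [v * u]mulrC S [v * x]mulrC -mulrDr addrC e mulr0.
  by apply/eqP; congr pair.
have vj : v - j / u != 0.
  apply: contra ij => /eqP e; rewrite -uv -[v](subrK (j / u)) e add0r.
  by rewrite mulrC divfK.
have uj : u - j / v != 0.
  apply: contra ij => /eqP e; rewrite -uv -[u](subrK (j / v)) e add0r.
  by rewrite divfK.
transitivity #|[set (- u, - (j / u)); (- (j / v), - v)]|; last first.
  by rewrite cards2 xpair_eqE eqr_opp -subr_eq0 (negPf uj).
apply: eq_card => -[x y]; rewrite !inE /= !xpair_eqE negb_and.
apply/and3P/orP => [[/eqP xy] | ].
  rewrite mulf_eq0 => /orP[] /eqP/addr0_eq e _; [left|right].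
    by rewrite -e eqxx /= -xy -e !mulNr opprK mulrC mulKf.
  by rewrite -e eqxx andbT -xy -e mulrN mulNr opprK mulfK.
case=> /andP[/eqP-> /eqP->].
  by rewrite mulrNN mulrC divfK // subrr mul0r !eqxx vj orbT.
by rewrite mulrNN divfK // subrr mulr0 !eqxx uj.
Qed.

Lemma hyperbola_swap (i : option F) A :
  (swap_pair A \in hyperbola i) = (A \in hyperbola i).
Proof.
case: A => u v; case: i => [i|] /=; [case: ifP => _|]; rewrite !inE /= ?xpair_eqE.
- by rewrite andbC.
- by rewrite mulrC.
- by rewrite mulrC (andbC (v == 0)).
Qed.

(** Swapping coordinates is additive and preserves every class; this reduces a point of the axes to
    the form (t, 0). *)
Lemma count_swap (j k : option F) A :
  #|[set B in hyperbola j | swap_pair A + B \in hyperbola k]| =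
  #|[set B in hyperbola j | A + B \in hyperbola k]|.
Proof.
have inj : injective (@swap_pair F F) by exact: can_inj swap_pairK.
rewrite -[LHS](card_preimset _ inj); apply: eq_card => B.
by rewrite !inE -(hyperbola_swap k (A + B)) -(hyperbola_swap j B).
Qed.

(** For A = (t, 0) the sum has product ty + j. Prescribing the value l of this product forces y = (l
    - j)/t, and then x = j/y exists exactly when l differs from j. *)
Lemma count_axes_hyperbola j (k : option F) A : j != 0 ->
    A \in hyperbola None ->
  #|[set B in hyperbola (Some j) | A + B \in hyperbola k]| =
    if (Some j != k) && (k != Some 0) then 1%N else 0%N.
Proof.
move=> j0 An; have [->|k0] := eqVneq k (Some 0).
  by rewrite (count_opposite _ _ _ An) andbF.
rewrite andbT; move: An.
wlog: A / exists2 t, t != 0 & A = (t, 0) => [WL | [t t0 ->] _].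
  move=> An; have /axesP[t t0 [] eA] := An; first by apply: WL => //; exists t.
  by rewrite -count_swap WL ?hyperbola_swap // eA; exists t.
have [<-|jk] := eqVneq (Some j) k.
  apply: eq_card0 => -[x y]; rewrite /= (negPf j0) !inE /= add0r.
  apply/negP => /andP[/eqP xy]; rewrite mulrDl xy -subr_eq0 addrK mulf_eq0 (negPf t0).
  by move=> /eqP y0; rewrite -xy y0 mulr0 eqxx in j0.
(* The value of the form on class [k]. The default 0 is the right value for [None], and [Some 0] is
   already excluded; for [None] the sum avoids the origin because y is non-zero. *)
pose l := odflt 0 k.
have lj : l - j != 0.
  rewrite /l subr_eq0 eq_sym; case: (k) jk => [k'|] //= _.
rewrite -[RHS](cards1 (j * t / (l - j), (l - j) / t)).
apply: eq_card => -[x y]; rewrite in_set in_set1.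
transitivity ((x * y == j) && ((t + x) * y == l)).
  rewrite /l; case: (k) k0 => [k'|] /=; rewrite (negPf j0) !inE /=.
    by move=> /negPf; rewrite -[Some k' == _]/(k' == 0) => ->; rewrite inE /= add0r.
  rewrite -[(t, 0) + _]/(t + x, 0 + y) add0r => _; case: eqP => //= xy.
  rewrite xpair_eqE negb_and.
  suff -> : y != 0 by rewrite orbT andbT.
  by apply: contra_eq_neq xy => ->; rewrite mulr0 eq_sym.
rewrite xpair_eqE; apply/andP/andP => [[/eqP xy /eqP]|[/eqP-> /eqP->]].
  rewrite mulrDl xy => /(canRL (addrK _)) ty.
  have y0 : y != 0 by apply: contra_neq j0 => y0; rewrite -xy y0 mulr0.
  by rewrite -ty -xy; split; apply/eqP; field; rewrite ?t0 ?y0.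
by split; apply/eqP; field; rewrite ?t0 ?lj.
Qed.

(** For A = (t, 0), a non-zero product k forces B onto the vertical axis, at (0, k/t), while a sum
    on the punctured axes forces B onto the horizontal one. *)
Lemma count_axes (k : option F) A : A \in hyperbola None ->
  #|[set B in hyperbola None | A + B \in hyperbola k]| =
    if k is Some _ then 1%N else (#|F| - 2)%N.
Proof.
move=> An; have [->|k0] := eqVneq k (Some 0); first by rewrite (count_opposite _ _ _ An).
move: An; wlog: A / exists2 t, t != 0 & A = (t, 0) => [WL | [t t0 ->] _].
  move=> An; have /axesP[t t0 [] eA] := An; first by apply: WL => //; exists t.
  by rewrite -count_swap WL ?hyperbola_swap // eA; exists t.
case: k k0 => [k k0|_]; last first.
  have inj : injective (fun x : F => (x, 0 : F)) by move=> u v [].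
  (* The excluded abscissas: 0 makes B the origin, -t makes A + B the origin. *)
  transitivity #|~: [set 0; - t]|; last first.
    by rewrite cardsCs setCK cards2 eq_sym oppr_eq0 t0.
  rewrite -[RHS](card_imset _ inj); apply: eq_card => -[x y].
  rewrite !inE -[(t, 0) + _]/(t + x, 0 + y) /= add0r.
  apply/idP/imsetP => [|[z]].
    rewrite !xpair_eqE !mulf_eq0; have [-> H|] := eqVneq y 0; last first.
      by rewrite orbF => _ /andP[/andP[/eqP-> _]]; rewrite addr0 (negPf t0).
    exists x => //; move: H; rewrite !orbT !andbT /= !inE negb_or.
    by rewrite addrC addr_eq0.
  rewrite !inE negb_or => /andP[z0 zt] [-> ->].
  by rewrite !mulr0 !xpair_eqE !eqxx !andbT /= z0 addrC addr_eq0.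
have {}k0 : k != 0 by [].
rewrite -[RHS](cards1 (0 : F, k / t)).
apply: eq_card => -[x y]; rewrite /= (negPf k0) !inE /= !xpair_eqE add0r.
apply/andP/andP => [[/andP[xy _] /eqP e] | [/eqP-> /eqP->]].
  have y0 : y != 0 by apply: contra_neq k0 => y0; rewrite -e y0 mulr0.
  move: xy; rewrite mulf_eq0 (negPf y0) orbF => /eqP x0.
  by rewrite x0 -e x0 addr0 eqxx mulrC mulKf.
by rewrite mul0r addr0 [t * _]mulrC divfK // !eqxx mulf_neq0 ?invr_eq0.
Qed.

End Counts.

Theorem theorem2 (F : finFieldType) (q : nat) (hF : #|F| = q)
    (q_odd : odd q) (q_mod4 : q = 1 %[mod 4]) (a b c : F)
    (a_neq0 : a != 0) (b_neq0 : b != 0) (c_neq0 : c != 0)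
    (hab : a * b = c ^+ 2) :
  (forall j k : option F,
     n a b (Some 0) j k = if j == k then 1 else 0) /\
  (forall i j : F, i != 0 -> j != 0 ->
     (forall k : F, k != 0 ->
        n a b (Some i) (Some j) (Some k) =
          if ~~ is_square (f i j k) then 0
          else if f i j k == 0 then 1 / (q%:R - 1)
          else 2 / (q%:R - 1)) /\
     n a b (Some i) (Some j) (Some 0) =
       (if i == j then 1 / (q%:R - 1) else 0) /\
     n a b (Some i) (Some j) None =
       (if i == j then 0 else 2 / (q%:R - 1))) /\
  (forall k : option F,
     (forall j : F, j != 0 ->
        n a b None (Some j) k =
          if (Some j != k) && (k != Some 0) then 1 / (q%:R - 1) else 0) /\
     n a b None None k =
       (if k is Some _ then 1 / (2 * (q%:R - 1))
        else (q%:R - 2) / (2 * (q%:R - 1)))).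
Proof.
subst q.
have [s s2] := sqrtN1_finField F q_mod4.
have F2 := odd_card_natr2_neq0 F q_odd.
have F1 := finNzRing_gt1 F.
have E i j k m Hm := n_hyperbola F a b c s i j k m F2 a_neq0 c_neq0 hab s2
  (card_hyperbola_gt0 F i) Hm.
(* Since [#|F|] exceeds 1, neither natural subtraction truncates, so the counts cast to q - 1 and q
   - 2. *)
have <- : #|F|.-1%:R = #|F|%:R - 1 :> rat by rewrite -subn1 natrB // ltnW.
have <- : (#|F| - 2)%:R = #|F|%:R - 2 :> rat by rewrite natrB.
split=> [j k | ].
  rewrite (E _ _ _ _ (count_origin F j k)); case: ifP; rewrite ?mul0r // divff //.
  by rewrite pnatr_eq0 -lt0n card_hyperbola_gt0.
split=> [i j i0 j0 | k].
  split=> [k k0|].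
    rewrite (E _ _ _ _ (fun A => count_hyperbola F s i j k A F2 s2 i0 j0 k0)).
    by rewrite card_hyperbola //; case: ifP => _; [rewrite mul0r | case: ifP].
  rewrite (E _ _ _ _ (count_opposite F (Some i) (Some j))).
  rewrite (E _ _ _ _ (fun A => count_hyperbola_axes F i j A i0 j0)).
  rewrite card_hyperbola // -[Some i == _]/(i == j).
  by split; case: ifP; rewrite ?mul0r.
split=> [j j0|].
  rewrite (E _ _ _ _ (fun A => count_axes_hyperbola F j k A j0)).
  by rewrite card_hyperbola //; case: ifP; rewrite ?mul0r.
rewrite (E _ _ _ _ (count_axes F k)) card_axes natrM.
by case: k.
Qed.
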